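(* If $G$ is a graph of minimum degree at least 2, then $M'(\overleftrightarrow{G}) \leq 3$.
   Context: Graphs are finite, simple and undirected. The symmetric digraph $\overleftrightarrow{G}$ is obtained from $G$ by replacing each edge $uv$ by the pair of opposite arcs $\overrightarrow{uv}$ and $\overrightarrow{vu}$. An arc coloring $c : A(D) \to [k]$ of a digraph $D$ is a majority arc coloring if for every vertex $u$ and every color $\alpha \in [k]$, at most half of the arcs entering $u$ have color $\alpha$ and at most half of the arcs leaving $u$ have color $\alpha$. $M'(D)$ is the least $k$ such that $D$ has a majority arc coloring with $k$ colors. *)

(* Defs.v *)
From mathcomp Require Import all_boot.

Set Implicit Arguments.
Unset Strict Implicit.
Unset Printing Implicit Defensive.

Record sgraph := SGraph {
  vertex : finType;
  adj : rel vertex;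
  adj_sym : symmetric adj;
  adj_irrefl : irreflexive adj
}.

Definition degree (G : sgraph) (u : vertex G) : nat :=
  #|[set v | adj u v]|.

(* At most one arc per ordered pair of vertices; opposite arcs are allowed. *)
Record digraph := Digraph {
  dvertex : finType;
  darc : rel dvertex
}.

(* The arc set A(D), as a finite type of ordered pairs (tail, head). *)
Definition arc (D : digraph) : finType :=
  {e : dvertex D * dvertex D | darc e.1 e.2}.

Definition arc_tail (D : digraph) (e : arc D) : dvertex D := (val e).1.
Definition arc_head (D : digraph) (e : arc D) : dvertex D := (val e).2.

Definition arcs_in (D : digraph) (u : dvertex D) : {set arc D} :=
  [set e | arc_head e == u].
Definition arcs_out (D : digraph) (u : dvertex D) : {set arc D} :=
  [set e | arc_tail e == u].

Definition majority_arc_coloring (D : digraph) (k : nat)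
    (c : {ffun arc D -> 'I_k}) : bool :=
  [forall u : dvertex D, forall a : 'I_k,
     (2 * #|[set e in arcs_in u | c e == a]| <= #|arcs_in u|) &&
     (2 * #|[set e in arcs_out u | c e == a]| <= #|arcs_out u|)].

Definition majority_arc_colorable (D : digraph) (k : nat) : bool :=
  [exists c : {ffun arc D -> 'I_k}, majority_arc_coloring c].

(* The least k, written M'(D). It is defined only for digraphs that have some
   majority arc coloring: there is none if, for example, some vertex has
   exactly one entering arc. Hence the argument [colD]; the value does not
   depend on which proof is given. *)
Definition majority_arc_index (D : digraph)
    (colD : exists k, majority_arc_colorable D k) : nat := ex_minn colD.

(* Every edge uv satisfies both adj u v and adj v u, so it gives the two
   opposite arcs. *)
Definition symmetric_digraph (G : sgraph) : digraph := Digraph (@adj G).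

(* Main.v *)
Require Import Defs.
From mathcomp Require Import all_boot all_fingroup zify.

Set Implicit Arguments.
Unset Strict Implicit.
Unset Printing Implicit Defensive.

(** The arcs of the symmetric digraph are the edges of a bipartite graph whose
    two sides are the tails and the heads.  Splitting every vertex of this
    graph into vertices of degree at most 3 and edge-coloring the result with
    3 colors by König's theorem gives a coloring in which a color occurs at
    most [ceil (d / 3)] times at a vertex of degree [d], and
    [ceil (d / 3) <= d / 2] for [d >= 2]. *)

(* A bipartite multigraph is encoded by its edge type [E] and the maps [l], [r]
   sending an edge to its two ends. *)
Definition proper_on (E : finType) (A : Type) (K : Type) (D : {set E})
    (l : E -> A) (c : E -> K) : Prop :=
  {in D &, forall e f, l e = l f -> c e = c f -> e = f}.

(** The edge [e] lies outside [D] and uses one of the at most [k] places at its end, so fewer than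
    [k] colors occur there. *)
Lemma missing_color (E : finType) (A : eqType) k (l : E -> A) (c : E -> 'I_k)
    (D : {set E}) (e : E) :
  #|[set f | l f == l e]| <= k -> e \notin D ->
  exists a, {in D, forall f, l f = l e -> c f != a}.
Proof.
move=> le_k eD; set F := [set f in D | l f == l e].
have ltF : #|c @: F| < k.
  apply: leq_ltn_trans (leq_imset_card _ _) (leq_trans _ le_k).
  apply: proper_card; apply/properP; split.
    by apply/subsetP=> f; rewrite !inE => /andP[].
  by exists e; rewrite !inE ?eqxx // (negbTE eD).
have [a aF] : exists a, a \notin c @: F.
  apply/existsP; rewrite -negb_forall; apply: contraL ltF => /forallP allF.
  rewrite -leqNgt -[k in k <= _]card_ord; apply: subset_leq_card.
  by apply/subsetP=> a _; apply: allF.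
exists a => f fD lf; apply: contraNneq aF => <-.
by apply: imset_f; rewrite inE fD lf eqxx.
Qed.

(* Following edges of alternating colors [a] and [b] from the right end of [e]
   only traverses color [a] from right to left and [b] from left to right, so
   that the walk never reaches the left end of [e], where [a] is missing. *)
Lemma kempe_swap (E : finType) (A B : eqType) k (l : E -> A) (r : E -> B)
    (D : {set E}) (c : E -> 'I_k) (e : E) (a b : 'I_k) :
  proper_on D l c -> proper_on D r c ->
  {in D, forall f, l f = l e -> c f != a} ->
  {in D, forall f, r f = r e -> c f != b} ->
  exists c' : E -> 'I_k, [/\ proper_on D l c', proper_on D r c',
    {in D, forall f, l f = l e -> c' f != a} &
    {in D, forall f, r f = r e -> c' f != a}].
Proof.
move=> cl cr ma mb.
pose R := [rel f g | (g \in D) &&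
  ([&& c f == a, c g == b & l f == l g] ||
   [&& c f == b, c g == a & r f == r g])].
pose start f := [&& f \in D, c f == a & r f == r e].
(* The Kempe chain is a reachable set: after [S_inv], only closure under [R] and the last step into
   an edge matter. *)
pose S := [set g | [exists f, start f && connect R f g]].
have S_start f : start f -> f \in S.
  by move=> sf; rewrite inE; apply/existsP; exists f; rewrite sf connect0.
have S_step f g : f \in S -> R f g -> g \in S.
  rewrite !inE => /existsP[h /andP[sh hf]] fg; apply/existsP; exists h.
  by rewrite sh (connect_trans hf) // connect1.
have S_inv g : g \in S -> start g \/ exists2 f, f \in S & R f g.
  rewrite inE => /existsP[h /andP[sh /connectP[p]]].
  elim/last_ind: p => [_ -> |p x _]; first by left.
  rewrite rcons_path last_rcons => /andP[hp Rx] ->; right.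
  exists (last h p) => //; rewrite inE; apply/existsP; exists h.
  by rewrite sh; apply/connectP; exists p.
(* A nonempty chain starts with an [a]-edge at the right end of [e], where [b] is missing. *)
have S_ab g : g \in S -> a != b.
  rewrite inE => /existsP[h /andP[/and3P[hD /eqP <- /eqP hr] _]].
  exact: mb.
have S_a g : g \in S -> c g = a ->
    g \in D /\ (r g = r e \/ exists f, [/\ f \in S, c f = b & r f = r g]).
  move=> gS ga; have ab := S_ab g gS.
  have [/and3P[gD _ /eqP rg]|[f fS /andP[gD]]] := S_inv g gS.
    by split; last left.
  case/orP=> /and3P[/eqP fc /eqP gc /eqP fg].
    by rewrite -ga -gc eqxx in ab.
  by split=> //; right; exists f.
have S_b g : g \in S -> c g = b ->
    g \in D /\ exists f, [/\ f \in S, c f = a & l f = l g].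
  move=> gS gb; have ab := S_ab g gS.
  have [/and3P[gD /eqP gc _]|[f fS /andP[gD]]] := S_inv g gS.
    by rewrite -gb -gc eqxx in ab.
  case/orP=> /and3P[/eqP fc /eqP gc /eqP fg]; last first.
    by rewrite -gb -gc eqxx in ab.
  by split=> //; exists f.
have S_D g : g \in S -> g \in D.
  by move=> gS; have [/and3P[]|[f _ /andP[]]] := S_inv g gS.
have S_col g : g \in S -> c g = a \/ c g = b.
  move=> gS; have [/and3P[_ /eqP-> _]|[f _ /andP[_]]] := S_inv g gS.
    by left.
  by case/orP=> /and3P[_ /eqP-> _]; [right | left].
pose c' g := if g \in S then tperm a b (c g) else c g.
(* A conflict after the swap can only occur between an edge in [S] and one outside, so it suffices
   that [S] absorbs such neighbors. *)
have proper_swap (T : eqType) (t : E -> T) : proper_on D t c ->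
    (forall f g, f \in S -> g \in D -> t f = t g ->
       c g = tperm a b (c f) -> g \in S) -> proper_on D t c'.
  move=> ct tS f g fD gD fg; rewrite /c'.
  case: ifP => fS; case: ifP => gS.
  - by move/perm_inj; apply: ct.
  - by move=> /esym/(tS f g fS gD fg); rewrite gS.
  - by move=> /(tS g f gS fD (esym fg)); rewrite fS.
  - exact: ct.
exists c'; split.
(* On the left, the walk continues from an [a]-edge to [g]; a [b]-edge was entered from an [a]-edge,
   which is [g] by properness. *)
- apply: proper_swap => // f g fS gD fg.
  have [fa|fb] := S_col f fS.
    rewrite fa tpermL => gb; apply: (S_step f) => //=.
    by rewrite gD fa gb fg !eqxx.
  rewrite fb tpermR => ga; have [_ [h [hS ha hf]]] := S_b f fS fb.
  by rewrite (_ : g = h) //; apply: (cl g h gD (S_D h hS)); rewrite ?hf ?ga.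
- apply: proper_swap => // f g fS gD fg.
  have [fa|fb] := S_col f fS; last first.
    rewrite fb tpermR => ga; apply: (S_step f) => //=.
    by rewrite gD fb ga fg !eqxx orbT.
  (* Either [f] starts the walk, and [g] contradicts the absence of [b], or [f] was entered from a
     [b]-edge, which must be [g]. *)
  rewrite fa tpermL => gb.
  have [_ [fe|[h [hS hb hf]]]] := S_a f fS fa.
    by have := mb g gD; rewrite -fg fe gb eqxx => /(_ erefl).
  by rewrite (_ : g = h) //; apply: (cr g h gD (S_D h hS)); rewrite ?hf ?gb.
- move=> f fD fe; rewrite /c'; case: ifP => fS; last exact: ma.
  have [fa|fb] := S_col f fS; first by have := ma f fD fe; rewrite fa eqxx.
  have [_ [h [hS ha hf]]] := S_b f fS fb.
  by have := ma h (S_D h hS); rewrite hf ha eqxx => /(_ fe).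
(* Every [a]-edge at the right end of [e] is a start, hence in [S], and is recolored [b]. *)
- move=> f fD fe; rewrite /c'; case: ifP => fS.
    have [fa|fb] := S_col f fS; last by have := mb f fD fe; rewrite fb eqxx.
    by rewrite fa tpermL eq_sym (S_ab f).
  apply: contraFneq fS => fa; apply: S_start.
  by rewrite /start fD fa fe !eqxx.
Qed.

(** Edges are colored one at a time: [kempe_swap] frees at the right end of the new edge a color
    already missing at its left end. *)
Lemma konig_edge_coloring (E : finType) (A B : eqType) k
    (l : E -> A) (r : E -> B) :
  (forall e, #|[set f | l f == l e]| <= k) ->
  (forall e, #|[set f | r f == r e]| <= k) ->
  exists c : E -> 'I_k, proper_on [set: E] l c /\ proper_on [set: E] r c.
Proof.
move=> kl kr; move: [set: E] => D.
have [n] := ubnP #|D|; elim: n D => // n IHn D; rewrite ltnS => leDn.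
have [->|[e eD]] := set_0Vmem D.
  (* Colorings are total on [E], so even an empty [D] needs a color for each edge; [e] itself forces
     [k] to be positive. *)
  have k_gt0 (e : E) : 0 < k.
    by apply: leq_trans _ (kl e); apply/card_gt0P; exists e; rewrite inE.
  exists (fun e => Ordinal (k_gt0 e)).
  by split=> f g; rewrite inE.
have [|c0 [cl0 cr0]] := IHn (D :\ e).
  by apply: leq_trans leDn; rewrite (cardsD1 e D) eD.
have eD' : e \notin D :\ e by rewrite !inE eqxx.
have [a ma] := missing_color c0 (kl e) eD'.
have [b mb] := missing_color c0 (kr e) eD'.
have [c [cl cr al ar]] := kempe_swap cl0 cr0 ma mb.
exists (fun f => if f == e then a else c f).
have extend (T : eqType) (t : E -> T) : proper_on (D :\ e) t c ->
    {in D :\ e, forall f, t f = t e -> c f != a} ->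
    proper_on D t (fun f => if f == e then a else c f).
  move=> ct mt f g fD gD /=.
  have [->|fe] := eqVneq f e; have [->|ge] := eqVneq g e => // fg.
  - by move/eqP; rewrite eq_sym (negbTE (mt g _ _)) // !inE ge.
  - by move/eqP; rewrite (negbTE (mt f _ _)) // !inE fe.
  - by apply: ct; rewrite // !inE ?fe ?ge.
by split; apply: extend.
Qed.

Section Splitting.

Variables (E : finType) (A : eqType) (k : nat) (t : E -> A).

Definition position (e : E) : nat := index e (enum [set f | t f == t e]).

(** These pairs are the split vertices: each copy of [t e] receives [k.+1] consecutive positions. *)
Definition block (e : E) : A * nat := (t e, position e %/ k.+1).

Lemma position_inj e f : t e = t f -> position e = position f -> e = f.
Proof.
by move=> tef; rewrite /position tef; apply: (index_inj e);
  rewrite mem_enum inE ?tef.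
Qed.

Lemma card_block e : #|[set f | block f == block e]| <= k.+1.
Proof.
pose g f : 'I_k.+1 := inord (position f %% k.+1).
rewrite -[leqRHS]card_ord -(@card_in_imset _ _ g) ?max_card //.
move=> f h; rewrite !inE => /eqP[tf pf] /eqP[th ph] /(congr1 val).
rewrite /= !inordK ?ltn_mod // => fh; apply: position_inj.
  by rewrite tf th.
by rewrite (divn_eq (position f) k.+1) pf -ph fh -divn_eq.
Qed.

(** A color occurs at most once per block, and the bound is the number of blocks at [u], a ceiling
    written as a floor. *)
Lemma card_color_le (K : eqType) (c : E -> K) u a :
  proper_on [set: E] block c ->
  #|[set e | (t e == u) && (c e == a)]| <=
    (#|[set e | t e == u]| + k) %/ k.+1.
Proof.
move=> pc; set d := #|[set e | t e == u]|; set m := leqRHS.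
have lt_m e : t e = u -> position e %/ k.+1 < m.
  move=> te; rewrite /m.
  have lt_d : position e < d.
    by rewrite /d /position cardE -te index_mem mem_enum inE.
  have : (position e + k.+1) %/ k.+1 <= (d + k) %/ k.+1.
    by apply: leq_div2r; rewrite addnS -addSn leq_add2r.
  by rewrite divnDr // divnn addn1.
have [m0|m_gt0] := posnP m.
  rewrite m0 leqn0 cards_eq0; apply/eqP/setP=> e; rewrite !inE.
  by apply/negP=> /andP[/eqP/lt_m]; rewrite m0.
(* [inord] needs a successor bound, hence the separate case [m = 0]; [lt_m] ensures that it never
   falls back to its default. *)
pose g e : 'I_m.-1.+1 := inord (position e %/ k.+1).
rewrite -(prednK m_gt0) -[leqRHS]card_ord -(@card_in_imset _ _ g) ?max_card //.
move=> e f; rewrite !inE => /andP[/eqP te /eqP ce] /andP[/eqP tf /eqP cf].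
move/(congr1 val); rewrite /= !inordK ?prednK ?lt_m // => ef.
by apply: pc; rewrite ?inE ?ce ?cf // /block te tf ef.
Qed.

End Splitting.

Lemma balanced_edge_coloring (E : finType) (A B : eqType) k
    (l : E -> A) (r : E -> B) :
  exists c : E -> 'I_k.+1,
    (forall u a, #|[set e | (l e == u) && (c e == a)]| <=
       (#|[set e | l e == u]| + k) %/ k.+1) /\
    (forall u a, #|[set e | (r e == u) && (c e == a)]| <=
       (#|[set e | r e == u]| + k) %/ k.+1).
Proof.
have [c [cl cr]] := konig_edge_coloring (card_block k l) (card_block k r).
by exists c; split=> u a; apply: card_color_le.
Qed.

Lemma card_arcs_out (G : sgraph) (u : vertex G) :
  #|@arcs_out (symmetric_digraph G) u| = degree u.
Proof.
rewrite -(@card_in_imset _ _ (fun e => (val e).2)).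
  apply: eq_card => v; rewrite inE; apply/imsetP/idP=> [[e]|uv].
    by rewrite inE => /eqP <- ->; apply: (valP e).
  by exists (exist _ (u, v) uv : Defs.arc (symmetric_digraph G)); rewrite ?inE /=.
move=> e f; rewrite !inE /arc_tail => /eqP eu /eqP fu ef; apply: val_inj.
by rewrite [LHS]surjective_pairing [RHS]surjective_pairing eu fu ef.
Qed.

Lemma card_arcs_in (G : sgraph) (u : vertex G) :
  #|@arcs_in (symmetric_digraph G) u| = degree u.
Proof.
rewrite -(@card_in_imset _ _ (fun e => (val e).1)).
  apply: eq_card => v; rewrite inE adj_sym; apply/imsetP/idP=> [[e]|uv].
    by rewrite inE => /eqP <- ->; apply: (valP e).
  by exists (exist _ (v, u) uv : Defs.arc (symmetric_digraph G)); rewrite ?inE /=.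
move=> e f; rewrite !inE /arc_head => /eqP eu /eqP fu ef; apply: val_inj.
by rewrite [LHS]surjective_pairing [RHS]surjective_pairing eu fu ef.
Qed.

Theorem theorem25 (G : sgraph) (min_degree_ge2 : forall u : vertex G, 2 <= degree u) :
  exists colG : (exists k, majority_arc_colorable (symmetric_digraph G) k),
    majority_arc_index colG <= 3.
Proof.
(* The minimum degree enters here: the inequality fails for [d = 1], [m = 1]. *)
have half d m : 2 <= d -> m <= (d + 2) %/ 3 -> 2 * m <= d by lia.
have col3 : majority_arc_colorable (symmetric_digraph G) 3.
  have [c [c_out c_in]] := balanced_edge_coloring 2
    (@arc_tail (symmetric_digraph G)) (@arc_head (symmetric_digraph G)).
  apply/existsP; exists (finfun c); apply/forallP=> u; apply/forallP=> a.
  apply/andP; split; apply: half.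
  - by rewrite card_arcs_in.
  - apply: leq_trans (c_in u a); apply: subset_leq_card.
    by apply/subsetP=> e; rewrite !inE ffunE.
  - by rewrite card_arcs_out.
  - apply: leq_trans (c_out u a); apply: subset_leq_card.
    by apply/subsetP=> e; rewrite !inE ffunE.
exists (ex_intro _ 3 col3); rewrite /majority_arc_index.
by case: ex_minnP => m _; apply.
Qed.
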